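(* For every odd integer $t\ge 3$ and every integer $m\ge 9$, $$\hat{r}(tK_2,P_m)\le \left\lceil\frac{3m+7}{2}\right\rceil+\frac{(t-3)(m+1)}{2}$$ and $$\hat{r}_c(tK_2,P_m)\le \left\lceil\frac{3m+7}{2}\right\rceil+\frac{(t-3)(m+2)}{2}.$$
   Context: All graphs are finite and simple. The size $e(F)$ of a graph $F$ is its number of edges. For graphs $F,G,H$, write $F\to(G,H)$ if for every coloring of the edges of $F$ with the colors red and blue, $F$ contains either a subgraph isomorphic to $G$ all of whose edges are red, or a subgraph isomorphic to $H$ all of whose edges are blue (subgraphs are not necessarily induced). The size Ramsey number $\hat{r}(G,H)$ is the smallest possible size of a graph $F$ with $F\to(G,H)$. The connected size Ramsey number $\hat{r}_c(G,H)$ is the smallest possible size of a connected graph $F$ with $F\to(G,H)$. $P_m$ denotes the path on $m$ vertices (with $m-1$ edges), and $tK_2$ is the disjoint union of $t$ edges (a matching of size $t$). *)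

(* Defs.v *)
From mathcomp Require Import all_boot.

Set Implicit Arguments.
Unset Strict Implicit.
Unset Printing Implicit Defensive.

Record sgraph := SGraph {
  vertex :> finType;
  adj : rel vertex;
  adj_sym : symmetric adj;
  adj_irrefl : irreflexive adj }.

Definition edges (F : sgraph) : {set {set F}} :=
  [set e | [exists x : F, exists y : F, adj x y && (e == [set x; y])]].

Definition gsize (F : sgraph) : nat := #|edges F|.

Definition connected (F : sgraph) : Prop :=
  0 < #|F| /\ forall x y : F, connect (@adj F) x y.

(* Not necessarily induced. *)
Definition contains_copy (F G : sgraph) : Prop :=
  exists2 f : G -> F, injective f & forall x y, adj x y -> adj (f x) (f y).

Inductive color := Red | Blue.

Definition is_color (a b : color) : bool :=
  match a, b with Red, Red | Blue, Blue => true | _, _ => false end.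

Section ColorClass.
Variables (F : sgraph) (c : {set F} -> color) (a : color).

Definition color_adj : rel F :=
  fun x y => adj x y && is_color a (c [set x; y]).

Lemma color_adj_sym : symmetric color_adj.
Proof. by move=> x y; rewrite /color_adj adj_sym setUC. Qed.

Lemma color_adj_irrefl : irreflexive color_adj.
Proof. by move=> x; rewrite /color_adj adj_irrefl. Qed.

Definition color_class : sgraph := SGraph color_adj_sym color_adj_irrefl.
End ColorClass.

(* A coloring is a function on all vertex sets; only its values on edges
   matter, since color_class only looks at those. *)
Definition arrows (F G H : sgraph) : Prop :=
  forall c : {set F} -> color,
    contains_copy (color_class c Red) G \/ contains_copy (color_class c Blue) H.

Definition is_min_size (P : sgraph -> Prop) (r : nat) : Prop :=
  (exists2 F, P F & gsize F = r) /\ (forall F, P F -> r <= gsize F).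

Lemma is_min_size_uniq P r1 r2 :
  is_min_size P r1 -> is_min_size P r2 -> r1 = r2.
Proof.
move=> [[F1 P1 <-] m1] [[F2 P2 <-] m2].
by apply/eqP; rewrite eqn_leq m1 // m2.
Qed.

Definition is_size_ramsey (G H : sgraph) (r : nat) : Prop :=
  is_min_size (fun F => arrows F G H) r.

Definition is_connected_size_ramsey (G H : sgraph) (r : nat) : Prop :=
  is_min_size (fun F => connected F /\ arrows F G H) r.

Section Path.
Variable m : nat.

Definition path_adj : rel 'I_m := fun i j => (i.+1 == j) || (j.+1 == i).

Lemma path_adj_sym : symmetric path_adj.
Proof. by move=> i j; rewrite /path_adj orbC. Qed.

Lemma path_adj_irrefl : irreflexive path_adj.
Proof. by move=> i; rewrite /path_adj orbb eqn_leq ltnn. Qed.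

Definition path_graph : sgraph := SGraph path_adj_sym path_adj_irrefl.
End Path.

Section Matching.
Variable t : nat.

(* The i-th edge of tK_2 joins (i, false) and (i, true). *)
Definition matching_adj : rel ('I_t * bool)%type :=
  fun u v => (u.1 == v.1) && (u.2 != v.2).

Lemma matching_adj_sym : symmetric matching_adj.
Proof. by move=> u v; rewrite /matching_adj eq_sym [u.2 == _]eq_sym. Qed.

Lemma matching_adj_irrefl : irreflexive matching_adj.
Proof. by move=> u; rewrite /matching_adj !eqxx. Qed.

Definition matching_graph : sgraph :=
  SGraph matching_adj_sym matching_adj_irrefl.
End Matching.

(* Main.v *)
From Stdlib Require Import Classical.
Require Import Defs.
From mathcomp Require Import all_boot zify.

Set Implicit Arguments.
Unset Strict Implicit.
Unset Printing Implicit Defensive.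

(* For t = 3 take k = floor ((m + 3) / 2) and the circulant graph on Z_2k with
   jumps k - 1, k, k + 1, a ladder of k rungs {x, x + k} closed up so that it is
   not bipartite; if m is odd, delete the rung {0, k}.  A closed walk of odd
   length l has displacement k + d with |d| <= l, so there is no cycle of length
   3 or 5.  In a graph without such cycles, a set of edges with no matching of
   size 3 is covered by two vertices u and v, so it suffices to find a path on m
   vertices avoiding any two given vertices.  Such paths zigzag through
   consecutive rungs: x, x + k, x + 1, x + 1 + k, ..., and skip one vertex of a
   few chosen rungs.  Finally F -> (sK_2, H) and F' -> (2K_2, H) imply that the
   disjoint union arrows ((s + 2)K_2, H), and C_{m+1} -> (2K_2, P_m); each such
   step costs m + 1 edges, plus one if the union has to be connected. *)

(** * Minimal sizes, and copies of paths and matchings *)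

(** Reduces each bound of the theorem to exhibiting one graph. As [P] need not be decidable, the
    descent to a minimum uses excluded middle. *)
Lemma ex_min_size (P : sgraph -> Prop) (F : sgraph) (N : nat) :
  P F -> gsize F <= N -> exists2 r, is_min_size P r & r <= N.
Proof.
have [n] := ubnP (gsize F); elim: n F => // n IH F ltFn PF leFN.
have [[G [PG ltGF]]|noG] := classic (exists G, P G /\ gsize G < gsize F).
  by apply: (IH G) => //; lia.
exists (gsize F) => //; split=> [|G PG]; first by exists F.
by rewrite leqNgt; apply/negP => ltGF; apply: noG; exists G.
Qed.

Lemma gsize_le (F : sgraph) (L : seq {set F}) :
  (forall x y : F, adj x y -> [set x; y] \in L) -> gsize F <= size L.
Proof.
move=> HL; apply: leq_trans (card_size L); apply/subset_leq_card/subsetP => e.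
by rewrite inE => /existsP[x /existsP[y /andP[/HL xyL /eqP->]]].
Qed.

Lemma path_copy (F : sgraph) (m : nat) (s : seq F) :
  0 < m -> uniq s -> sorted (@adj F) s -> m <= size s ->
  contains_copy F (path_graph m).
Proof.
case: s => [|x0 s0]; first by case: m.
move: (x0 :: s0) => s m_gt0 us ss ms.
have lts (i : 'I_m) : i < size s by exact: leq_trans ms.
exists (fun i : 'I_m => nth x0 s i) => [i j /eqP|i j].
  by rewrite nth_uniq // => /eqP/val_inj.
move/sortedP: ss => /(_ x0) ss; have [li lj] := (lts i, lts j).
case/orP => /eqP eij; [|rewrite adj_sym]; rewrite -eij; apply: ss; lia.
Qed.

Lemma red_or_blue (F : sgraph) (c : {set F} -> color) (x y : F) :
  adj x y -> color_adj c Red x y \/ color_adj c Blue x y.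
Proof. by rewrite /color_adj => ->; case: (c _); [left|right]. Qed.

Lemma matching_copy (F : sgraph) (s : seq (F * F)) :
  all (fun e => adj e.1 e.2) s -> uniq (map fst s ++ map snd s) ->
  contains_copy F (matching_graph (size s)).
Proof.
case: s => [_ _|e0 s0].
  have f0 : 'I_0 * bool -> F by case=> -[].
  by exists f0 => [[[]]|[[]]].
move: (e0 :: s0) => s /(all_nthP e0) adjs us.
(* Position of a matching vertex in the list of all first ends followed by all second ends;
   uniqueness of that list gives injectivity. *)
pose g (u : 'I_(size s) * bool) := nat_of_ord u.1 + u.2 * size s.
have lt_g u : g u < size (map fst s ++ map snd s).
  by rewrite size_cat !size_map; case: u => i []; have := ltn_ord i; rewrite /g /=; lia.
have gE u : nth e0.1 (map fst s ++ map snd s) (g u) =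
    (if u.2 then snd else fst) (nth e0 s u.1).
  case: u => i [] /=; rewrite nth_cat size_map /g /= ?mul1n ?addn0 ?ltn_ord.
    by rewrite ltnNge leq_addl /= addnK (nth_map e0).
  by rewrite (nth_map e0).
exists (fun u => nth e0.1 (map fst s ++ map snd s) (g u)).
  move=> u v /eqP; rewrite nth_uniq // => /eqP.
  case: u v => [i x] [j y]; have [li lj] := (ltn_ord i, ltn_ord j).
  rewrite /g /= => eqg; suff [/val_inj-> ->] : i = j :> nat /\ x = y by [].
  by case: x y eqg => [] [] /=; lia.
move=> [i x] [j y] /andP[/= /eqP<-]; rewrite !gE /= => xy.
by case: x y xy => [] [] // _; [rewrite adj_sym|]; exact: adjs (ltn_ord i).
Qed.

(** * Vertex covers of graphs with small matching number *)

Definition C3_free (F : sgraph) : Prop :=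
  forall x y z : F, adj x y -> adj y z -> adj z x -> False.

Definition C5_free (F : sgraph) : Prop :=
  forall x y z u v : F, adj x y -> adj y z -> adj z u -> adj u v -> adj v x -> False.

Lemma C3_free_color (F : sgraph) (c : {set F} -> color) a :
  C3_free F -> C3_free (color_class c a).
Proof.
by move=> H x y z /andP[xy _] /andP[yz _] /andP[zx _]; exact: (H x y z).
Qed.

Lemma C5_free_color (F : sgraph) (c : {set F} -> color) a :
  C5_free F -> C5_free (color_class c a).
Proof.
move=> H x y z u v /andP[xy _] /andP[yz _] /andP[zu _] /andP[uv _] /andP[vx _].
exact: (H x y z u v).
Qed.

Definition covers (F : sgraph) (s : seq F) : Prop :=
  forall x y : F, adj x y -> (x \in s) || (y \in s).

Ltac neqs := rewrite /= ?inE; do ?[case: eqP => //= ?; try congruence].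

Lemma adj_neq (F : sgraph) (x y : F) : adj x y -> x != y.
Proof. by apply: contraTneq => ->; rewrite adj_irrefl. Qed.

(** Pairwise intersecting edges form a star or a triangle. If no vertex covers, an edge ab meets an
    edge missing a in b and an edge missing b in a; these two edges meet outside ab and close a
    triangle. *)
Lemma cover1 (F : sgraph) (x0 : F) : C3_free F ->
  ~ contains_copy F (matching_graph 2) -> exists u : F, covers [:: u].
Proof.
move=> noC3 noM.
have disj (a b c d : F) : adj a b -> adj c d -> [|| a == c, a == d, b == c | b == d].
  move=> ab cd; apply: contra_notT noM; rewrite !negb_or => /and4P[ac ad bc bd].
  apply: (@matching_copy _ [:: (a, b); (c, d)]); rewrite /= ?ab ?cd //.
  by rewrite !inE !negb_or (adj_neq ab) (adj_neq cd) ac ad bd [c == b]eq_sym bc.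
apply: NNPP => noc.
have out (u : F) : exists x y, [/\ adj x y, x != u & y != u].
  apply: NNPP => H; apply: noc; exists u => x y xy; rewrite !inE.
  by case: eqVneq => //= xu; apply/negPn/negP => yu; apply: H; exists x, y.
have [a [b [ab _ _]]] := out x0.
have nbr (p q : F) : adj p q -> exists2 x, adj q x & x != p.
  move=> pq; have [x [y [xy xp yp]]] := out p.
  have := disj _ _ _ _ pq xy; rewrite ![p == _]eq_sym (negPf xp) (negPf yp) /=.
  by case/orP => /eqP->; [exists y|exists x; rewrite // adj_sym].
have [y b_y ya] := nbr _ _ ab.
have [x a_x xb] : exists2 x, adj a x & x != b by apply: nbr; rewrite adj_sym.
have := disj _ _ _ _ a_x b_y; rewrite (negPf (adj_neq ab)) [a == y]eq_sym.
rewrite (negPf ya) (negPf xb) => /eqP exy.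
by apply: (noC3 a b y) => //; rewrite adj_sym -exy.
Qed.

(** If ab and cd are disjoint edges, then every edge meets them, and at most one end of each has a
    neighbour outside them: two such ends would share that neighbour, closing a triangle, or yield
    three disjoint edges. *)
Lemma cover2 (F : sgraph) (x0 : F) : C3_free F -> C5_free F ->
  ~ contains_copy F (matching_graph 3) -> exists u v : F, covers [:: u; v].
Proof.
move=> noC3 noC5 noM.
have [[f f_inj f_adj]|noM2] := classic (contains_copy F (matching_graph 2)); last first.
  have [u cu] := cover1 x0 noC3 noM2; exists u, u => x y /cu.
  by rewrite !inE !orbb.
have disj (a b c d e g : F) : adj a b -> adj c d -> adj e g ->
    ~~ uniq [:: a; c; e; b; d; g].
  move=> ab cd eg; apply: contra_notN noM => us.
  by apply: (@matching_copy _ [:: (a, b); (c, d); (e, g)]); rewrite //= ab cd eg.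
pose out a b c d (x : F) := x \notin [:: a; b; c; d].
pose good (a b c d : F) := [/\ adj a b, adj c d & uniq [:: a; b; c; d]].
have outer (P : pred F) q : ~ (forall x, adj q x -> ~~ P x) -> exists2 x, adj q x & P x.
  by move=> nq; apply: NNPP => H; apply: nq => x qx; apply/negP => Px; apply: H; exists x.
have oneside a b c d : good a b c d ->
    (forall x, adj a x -> ~~ out a b c d x) \/ (forall x, adj b x -> ~~ out a b c d x).
  case=> ab cd us; apply: NNPP => /not_or_and[/outer[x ax ox] /outer[y b_y oy]].
  have [exy|nxy] := eqVneq x y.
    by apply: (noC3 a b y) => //; rewrite adj_sym -exy.
  have := disj _ _ _ _ _ _ ax b_y cd; move: us ox oy; rewrite /out /= !inE.
  by move: nxy; neqs.
(* Koenig's argument: if only a and c have neighbours outside the two edges,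
   then {a, c}, {a, d} or {b, c} is a cover. *)
have key a b c d : good a b c d ->
    (forall x, adj b x -> ~~ out a b c d x) -> (forall x, adj d x -> ~~ out a b c d x) ->
    exists u v : F, covers [:: u; v].
  case=> ab cd us nb nd.
  have touch x y : adj x y -> out a b c d x -> out a b c d y -> False.
    move=> xy ox oy; have := disj _ _ _ _ _ _ ab cd xy.
    move: us ox oy (adj_neq xy); rewrite /out /= !inE.
    by neqs.
  have cov p q p' q' : (forall z, ~~ out a b c d z -> z \in [:: p; q; p'; q']) ->
      (forall z, adj p' z -> ~~ out a b c d z) ->
      (forall z, adj q' z -> ~~ out a b c d z) -> ~~ adj p' q' ->
      exists u v : F, covers [:: u; v].
    move=> all4 np nq npq; exists p, q => x y xy.
    apply/negPn/negP; rewrite negb_or => /andP[xpq ypq].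
    have cases z : z \notin [:: p; q] -> [\/ out a b c d z, z = p' | z = q'].
      case: (boolP (out a b c d z)) => [oz|/all4]; first by constructor 1.
      rewrite !inE => z4 /norP[/negPf zp /negPf zq]; move: z4; rewrite zp zq /=.
      by case/orP => /eqP->; [constructor 2|constructor 3].
    case: (cases _ xpq) (cases _ ypq) xy => [ox|->|->] [oy|->|->].
    - by move=> xy; case: (touch _ _ xy ox oy).
    - by rewrite adj_sym => /np; rewrite ox.
    - by rewrite adj_sym => /nq; rewrite ox.
    - by move/np; rewrite oy.
    - by rewrite adj_irrefl.
    - by rewrite (negPf npq).
    - by move/nq; rewrite oy.
    - by rewrite adj_sym (negPf npq).
    - by rewrite adj_irrefl.
  have [bd|nbd] := boolP (adj b d); last first.
    by apply: (cov a c b d) => // z; rewrite /out negbK !inE; do ![case: eqP => //= _].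
  have [nc|oc] := classic (forall x, adj c x -> ~~ out a b c d x).
    apply: (cov a d b c) => // [z|].
      by rewrite /out negbK !inE; do ![case: eqP => //= _].
    by apply/negP => bc; apply: (noC3 b d c) => //; rewrite adj_sym.
  have [na|oa] := classic (forall x, adj a x -> ~~ out a b c d x).
    apply: (cov b c a d) => // [z|].
      by rewrite /out negbK !inE; do ![case: eqP => //= _].
    by apply/negP => ad; apply: (noC3 a b d) => //; rewrite adj_sym.
  (* Now x, a, b, d, c, y is an augmenting walk: if x = y it closes to a 5-cycle, otherwise ax, bd,
     cy is a matching of size 3. *)
  have [x ax ox] := outer _ _ oa; have [y cy oy] := outer _ _ oc.
  have [exy|nxy] := eqVneq x y.
    by case: (noC5 a b d c y) => //; [rewrite adj_sym|rewrite -exy adj_sym].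
  have := disj _ _ _ _ _ _ ax cy bd; move: us ox oy; rewrite /out /= !inE.
  by move: nxy; neqs.
have outs1 a b c d z : out b a c d z = out a b c d z by rewrite /out !inE; neqs.
have outs2 a b c d z : out c d a b z = out a b c d z by rewrite /out !inE; neqs.
have outs3 a b c d z : out a b d c z = out a b c d z by rewrite /out !inE; neqs.
pose e i := f (i : 'I_2, false); pose g i := f (i : 'I_2, true).
have eg i : adj (e i) (g i) by apply: f_adj; rewrite /= /matching_adj /= eqxx.
have gd : good (e ord0) (g ord0) (e ord_max) (g ord_max).
  by split=> //; rewrite /= !inE !negb_or /e /g !(inj_eq f_inj).
have swap1 a b c d : good a b c d -> good b a c d.
  by case=> ab cd us; split; [rewrite adj_sym|exact: cd|
    move: us; neqs].
have swap2 a b c d : good a b c d -> good c d a b.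
  case=> ab cd us; split=> //; move: us; neqs.
move: gd; move: (e _) (g _) (e _) (g _) => c d a b gd.
(* The ends of each edge are named so that b and d have no outside neighbours. *)
wlog nb : a b gd / forall x, adj b x -> ~~ out a b c d x.
  move=> W; case: (oneside _ _ _ _ gd) => [na|nb]; last exact: (W a b).
  by apply: (W b a); [exact: swap1|move=> x /na; rewrite (outs1 a b)].
wlog nd : c d gd nb / forall x, adj d x -> ~~ out a b c d x; last exact: key nb nd.
have gd' := swap2 _ _ _ _ gd.
move=> W; case: (oneside _ _ _ _ gd') => [nc|nd].
  by apply: (W d c) => [|x /nb|x /nc]; [exact/swap2/swap1
    |rewrite (outs3 a b c)|rewrite (outs3 a b c) (outs2 a b)].
by apply: (W c d) => // x /nd; rewrite (outs2 a b).
Qed.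

(** * Long paths in a ladder avoiding two vertices *)

Section Zigzag.
Variables (k r : nat).

(* Adjacency in the ladder for representatives modulo 2k, with the rung
   {r, r + k} deleted; r = k (never a residue) means that no rung is. *)
Definition step_adj (x y : nat) : bool :=
  [|| y == x + k.+1 %[mod k.*2], y == x + k.-1 %[mod k.*2]
    | (y == x + k %[mod k.*2]) && (x %% k != r)].

(* The zigzag visits the rungs q = p, p + 1, ... (residues modulo k) and enters
   rung q at zpos q.  It leaves a rung of ss at its entry vertex and every other
   rung at the opposite vertex, so each rung of ss shifts the later entry points
   by k. *)
Variables (c : nat) (ss : seq nat).

Definition zpos (q : nat) : nat := q + k * (c + count (fun s => s < q) ss).

Definition zrung (q : nat) : seq nat :=
  if q \in ss then [:: zpos q] else [:: zpos q; zpos q + k].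

Definition zig (p l : nat) : seq nat := flatten [seq zrung q | q <- iota p l].

Lemma zposS q : uniq ss -> zpos q.+1 = zpos q + 1 + k * (q \in ss).
Proof.
move=> us; rewrite /zpos -(count_uniq_mem _ us).
suff -> : count (fun s => s < q.+1) ss = count (fun s => s < q) ss + count_mem q ss by lia.
rewrite -count_predUI.
rewrite [X in _ = _ + X](@eq_count _ _ pred0) ?count_pred0 ?addn0; last by move=> x /=; lia.
by apply: eq_count => x /=; lia.
Qed.

Lemma zpos_mod q : zpos q = q %[mod k].
Proof. by rewrite /zpos addnC mulnC modnMDl. Qed.

(** The next rung is always reached by a jump of k + 1. From [zpos q + k] it ends at [zpos q + 1]
    modulo 2k, from [zpos q] at [zpos q + 1 + k]; the difference is the shift caused by a rung of
    [ss]. Rungs of [ss] are not traversed, so the deleted rung may be among them. *)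
Lemma zig_path x p l : uniq ss -> 0 < k -> step_adj x (zpos p) ->
  (forall q, p <= q < p + l -> q \notin ss -> q %% k != r) ->
  path step_adj x (zig p l).
Proof.
move=> us k_gt0; elim: l x p => // l IH x p xp nr.
have IHp y : step_adj y (zpos p.+1) -> path step_adj y (zig p.+1 l).
  by move=> yp; apply: IH => // q ?; apply: nr; lia.
rewrite /zig /= -/(zig p.+1 l) /zrung.
have E := zposS p us; case: ifPn => pss /=; rewrite xp /=.
  by apply: IHp; rewrite /step_adj E pss muln1 -addnA add1n eqxx.
rewrite {1}/step_adj eqxx zpos_mod nr ?orbT ?pss //=; last by lia.
apply: IHp; rewrite /step_adj E (negPf pss) muln0 addn0.
suff -> : zpos p + k + k.+1 = zpos p + 1 + k.*2 by rewrite modnDr eqxx.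
lia.
Qed.

Lemma zigP p l x : x \in zig p l ->
  exists2 q, p <= q < p + l & x = zpos q \/ (x = zpos q + k /\ q \notin ss).
Proof.
case/flatten_mapP => q; rewrite mem_iota => lq; rewrite /zrung => xq.
exists q => //; move: xq; case: ifPn => qss; rewrite !inE; first by move/eqP; left.
by case/orP => /eqP; [left|right].
Qed.

Lemma zig_mod p l x : x \in zig p l -> exists2 q, p <= q < p + l & x = q %[mod k].
Proof.
case/zigP => q lq H; exists q => //.
by case: H => [->|[-> _]]; rewrite ?modnDr zpos_mod.
Qed.

Lemma modn_window p q q' : p <= q < p + k -> p <= q' < p + k -> q = q' %[mod k] -> q = q'.
Proof.
move=> lq lq' /eqP; wlog le : q q' lq lq' / q' <= q.
  by move=> W; case: (leqP q' q) => [|/ltnW] le E; [|apply/esym]; apply: W => //; rewrite eq_sym.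
rewrite eqn_mod_dvd // => /dvdnP[[|a]]; lia.
Qed.

Lemma modn_shift x : 0 < k -> x + k = x %[mod k.*2] -> False.
Proof.
move=> k_gt0 /eqP; rewrite -[X in _ == X %[mod _]]addn0 eqn_modDl mod0n modn_small; lia.
Qed.

Lemma modn_of_double x y : x = y %[mod k.*2] -> x = y %[mod k].
Proof.
have d2 : k %| k.*2 by rewrite -mul2n dvdn_mull.
by move=> E; rewrite -(modn_dvdm x d2) E modn_dvdm.
Qed.

(** Different rungs of a window of length at most k differ modulo k, and the two ends of one rung
    differ by k modulo 2k. *)
Lemma zig_uniq p l : 0 < k -> l <= k -> uniq (map (modn^~ k.*2) (zig p l)).
Proof.
move=> k_gt0; elim: l p => // l IH p lk.
rewrite /zig /= -/(zig p.+1 l) map_cat cat_uniq IH ?andbT; last by lia.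
apply/andP; split.
  rewrite /zrung; case: ifP => //= _; rewrite andbT inE.
  by apply/eqP => /esym/modn_shift; exact.
apply/hasPn => _ /mapP[x /zig_mod[q lq xq] ->].
apply/mapP => -[y yp /modn_of_double]; rewrite xq.
have -> : y = p %[mod k].
  by move: yp; rewrite /zrung; case: ifP => _; rewrite !inE;
    [|case/orP]; move/eqP->; rewrite ?modnDr zpos_mod.
by move/(@modn_window p); lia.
Qed.

Lemma size_zig p l :
  2 * l <= size (zig p l) + size [seq s <- ss | p <= s < p + l].
Proof.
have le : count (mem ss) (iota p l) <= size [seq s <- ss | p <= s < p + l].
  rewrite -size_filter; apply: uniq_leq_size; first by rewrite filter_uniq ?iota_uniq.
  by move=> x; rewrite !mem_filter mem_iota andbC.
suff E : size (zig p l) + count (mem ss) (iota p l) = 2 * l by rewrite -E leq_add2l.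
elim: l p {le} => // l IH p; rewrite /zig /= size_cat -/(zig p.+1 l) /zrung.
by have := IH p.+1; case: ifP => _ /=; lia.
Qed.
End Zigzag.

(* The two avoided vertices are 0 and D. *)
Definition long_path (k r D : nat) (s : seq nat) : Prop :=
  [/\ sorted (step_adj k r) s, uniq (map (modn^~ k.*2) s),
      2 * k - 2 - (r < k) <= size s &
      (forall x, x \in s -> x %% k.*2 != 0 /\ x %% k.*2 != D)].

Lemma zig_sorted k r c ss p l : uniq ss -> 0 < k ->
  (forall q, p <= q < p + l -> q \notin ss -> q %% k != r) ->
  sorted (step_adj k r) (zig k c ss p l).
Proof.
move=> us k0 nr.
(* An artificial predecessor of the first vertex: a jump of k + 1 from it lands at [zpos p + 2k]. *)
suff: path (step_adj k r) (zpos k c ss p + k.-1) (zig k c ss p l) by move/path_sorted.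
apply: zig_path => //; rewrite /step_adj -addnA.
by rewrite (_ : k.-1 + k.+1 = k.*2) ?modnDr ?eqxx //; lia.
Qed.

(** The zigzag misses y if it enters the rung of y at the opposite end y + k and leaves from
    there. *)
Lemma zig_avoid k c ss p l y : 0 < k -> l <= k ->
  (forall q, p <= q < p + l -> q = y %[mod k] -> q \in ss /\ zpos k c ss q = y + k %[mod k.*2]) ->
  forall x, x \in zig k c ss p l -> x <> y %[mod k.*2].
Proof.
move=> k0 lk H x /zigP[q lq Hx] xy.
have qy : q = y %[mod k].
  rewrite -(modn_of_double xy); case: Hx => [->|[-> _]]; rewrite ?modnDr zpos_mod //.
have [qss E] := H q lq qy; case: Hx => [xq|[_]]; last by rewrite qss.
by apply: (@modn_shift k y) => //; rewrite -E -xq.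
Qed.

Section LongPath.
Variables (k r D : nat).
Hypotheses (k_ge : 3 <= k) (r_le : r <= k) (D_le : D <= k).

(** Both avoided vertices lie in rung 0, so the zigzag runs through the other k - 1 rungs and loses
    at most one more vertex, at the deleted rung. *)
Lemma long_path_ends : D = 0 \/ D = k -> exists s, long_path k r D s.
Proof.
move=> D0; pose ss := if r < k then [:: r] else [::].
exists (zig k 0 ss 1 k.-1); split.
- apply: zig_sorted; rewrite /ss; [by case: ifP|lia|].
  by move=> q lq; rewrite modn_small; [case: ifP; rewrite ?inE //|]; lia.
- by apply: zig_uniq; lia.
- have := size_zig k 0 ss 1 k.-1; rewrite /ss; case: ifP => rk /=; last by lia.
  by case: ifP => /=; lia.
move=> x /zig_mod[q lq xq].
have nz : x %% k != 0 by rewrite xq modn_small; lia.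
have dv : k %| k.*2 by rewrite -mul2n dvdn_mull.
split; apply: contraNneq nz; rewrite -(modn_dvdm x dv) => ->; rewrite ?mod0n //.
by case: D0 => ->; rewrite ?mod0n ?modnn.
Qed.

Lemma avoid_residues (s : seq nat) : 0 < D < k -> (forall x, x \in s -> x <> 0 %[mod k.*2]) ->
  (forall x, x \in s -> x <> D %[mod k.*2]) ->
  (forall x, x \in s -> x %% k.*2 != 0 /\ x %% k.*2 != D).
Proof.
move=> lD H0 HD x xs; split; apply/eqP.
  by move: (H0 x xs); rewrite mod0n.
by move: (HD x xs); rewrite [D %% _]modn_small; lia.
Qed.

(** Starting with c = 1, rung D is entered at D + k and D is skipped. The resulting shift makes the
    zigzag enter rung 0, which is q = k here, at the vertex k, so 0 is skipped too. A deleted rung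
    is one of these two and costs nothing extra. *)
Lemma long_path_through : 0 < D < k -> r \in [:: 0; D; k] -> exists s, long_path k r D s.
Proof.
move=> lD rD; pose ss := [:: D; k].
have uss : uniq ss by rewrite /= inE; lia.
exists (zig k 1 ss D k); split.
- apply: zig_sorted => //; first by lia.
  move=> q lq; rewrite !inE => nq.
  have [qk|kq] := ltnP q k; first by rewrite modn_small //; move: rD; rewrite !inE; lia.
  rewrite -(subnK kq) modnDr modn_small; last by lia.
  by move: rD; rewrite !inE; lia.
- by apply: zig_uniq; lia.
- have := size_zig k 1 ss D k; rewrite /= => S; move: rD S; rewrite !inE.
  by do ![case: ifP => /=]; lia.
apply: avoid_residues => //; apply: zig_avoid; rewrite ?leqnn //; try lia.
  move=> q lq; rewrite mod0n => /eqP q0.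
  have -> : q = k by apply: (@modn_window k D) => //; [lia|rewrite modnn; exact/eqP].
  rewrite !inE eqxx orbT; split=> //; rewrite /zpos /= ltnn (_ : D < k) //; last by lia.
  by rewrite (_ : k + _ = 0 + k + k.*2) ?modnDr //; lia.
move=> q lq E; have -> : q = D by apply: (@modn_window k D) => //; lia.
rewrite !inE eqxx; split=> //; rewrite /zpos /= ltnn (_ : k < D = false) ?addn0 ?muln1 //; lia.
Qed.

(** Rung 0 is entered at k. The shifts at rungs 0 and r cancel modulo 2k, so rung D is entered at D
    + k, as needed to skip D. *)
Lemma long_path_before : 0 < r < D -> D < k -> exists s, long_path k r D s.
Proof.
move=> lr lD; pose ss := [:: 0; r; D].
have uss : uniq ss by rewrite /= !inE; lia.
exists (zig k 1 ss 0 k); split.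
- apply: zig_sorted => //; first by lia.
  by move=> q lq; rewrite !inE modn_small; lia.
- by apply: zig_uniq; lia.
- have := size_zig k 1 ss 0 k; rewrite /=.
  by do ![case: ifP => /=]; lia.
apply: avoid_residues; first (by lia); apply: zig_avoid; rewrite ?leqnn //; try lia.
  move=> q lq E; have -> : q = 0 by apply: (@modn_window k 0) => //; lia.
  by rewrite !inE eqxx; split=> //; rewrite /zpos /= ?ltn0 ?addn0 ?muln1.
move=> q lq E; have -> : q = D by apply: (@modn_window k 0) => //; lia.
rewrite !inE eqxx !orbT; split=> //; rewrite /zpos /= ltnn.
have [-> ->] : (0 < D) = true /\ (r < D) = true by lia.
by rewrite (_ : D + k * _ = D + k + k.*2) ?modnDr //; lia.
Qed.

(** Rung r is split between the two ends of the path: r + k comes first and r last. In between, 0 is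
    skipped at q = k and D at q = k + D; the parity this requires is obtained by dropping one vertex
    of rung 1, a rung different from rung D because D > 1. *)
Lemma long_path_after : 1 < D < r -> r < k -> exists s, long_path k r D s.
Proof.
move=> lD lr; pose ss := [:: k; k.+1; k + D; k + r].
have uss : uniq ss by rewrite /= !inE; lia.
have z1 : zpos k 2 ss r.+1 = r.+1 + 2 * k.
  have e x : r < x -> (x < r.+1) = false by lia.
  by rewrite /zpos /= !e; lia.
have inss q : r.+1 <= q < r.+1 + k -> q \notin ss -> q %% k != r.
  move=> lq; rewrite !inE => nq; have [qk|kq] := ltnP q k.
    by rewrite modn_small //; lia.
  rewrite -(subnK kq) modnDr modn_small; lia.
exists ((r + k) :: zig k 2 ss r.+1 k); split.
- rewrite /=; apply: zig_path => //; first by lia.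
  rewrite z1 /step_adj (_ : r.+1 + 2 * k = r + k + k.+1) ?eqxx //; lia.
- rewrite /= zig_uniq ?andbT //; last by lia.
  apply/mapP => -[x xz E]; have k0 : 0 < k by lia.
  apply: (zig_avoid k0 (leqnn k) (y := r + k) _ xz) => // q lq; rewrite modnDr => Eq.
  have -> : q = k + r by apply: (@modn_window k r.+1) => //; [lia|rewrite modnDl].
  rewrite !inE eqxx !orbT; split=> //; rewrite /zpos /= ltnn.
  have [-> -> ->] : [/\ (k < k + r) = true, (k.+1 < k + r) = true & (k + D < k + r) = true].
    by split; lia.
  by rewrite (_ : k + r + k * _ = r + k + k + k.*2 + k.*2) ?modnDr //; lia.
- have := size_zig k 2 ss r.+1 k; rewrite /=.
  by do ![case: ifP => /=]; lia.
have rk : (r + k) %% k.*2 = r + k by rewrite modn_small; lia.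
move=> x; rewrite inE => /predU1P[->|]; first by rewrite rk; lia.
move: x; apply: avoid_residues; first (by lia); apply: zig_avoid; rewrite ?leqnn //; try lia.
  move=> q lq; rewrite mod0n => Eq.
  have -> : q = k by apply: (@modn_window k r.+1) => //; [lia|rewrite modnn].
  rewrite !inE eqxx; split=> //; rewrite /zpos /=.
  have [-> -> -> ->] : [/\ (k < k) = false, (k.+1 < k) = false,
      (k + D < k) = false & (k + r < k) = false].
    by split; lia.
  by rewrite (_ : k + k * _ = 0 + k + k.*2) ?modnDr //; lia.
move=> q lq Eq.
have -> : q = k + D by apply: (@modn_window k r.+1) => //; [lia|rewrite modnDl].
rewrite !inE eqxx !orbT; split=> //; rewrite /zpos /= ltnn.
have [-> -> ->] : [/\ (k < k + D) = true, (k.+1 < k + D) = true & (k + r < k + D) = false].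
  by split; lia.
by rewrite (_ : k + D + k * _ = D + k + k.*2 + k.*2) ?modnDr //; lia.
Qed.
End LongPath.

(* The path runs along one rail, crosses one rung and returns along the other
   rail. *)
Lemma rail_loop k r (A : nat -> nat) h : 3 <= k -> h \in [:: k.+1; k.-1] ->
  (forall q, q < k - 2 -> A q.+1 = A q + h) ->
  {in gtn k.-1 &, injective (fun q => A q %% k)} -> A (k - 2) %% k != r ->
  exists s, [/\ sorted (step_adj k r) s, uniq (map (modn^~ k.*2) s), size s = 2 * k - 3 &
    forall x, x \in s -> exists2 q, q <= k - 2 & x = A q \/ (0 < q /\ x = A q + k)].
Proof.
move=> k3 hk AS Ainj Ar.
(* Outward along A 0, ..., A (k - 2), then back along A (k - 2) + k, ..., A 1 + k. The vertex A 0 +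
   k is left out. *)
pose idx t := if t <= k - 2 then t else 2 * k - 3 - t.
pose f t := A (idx t) + (if t <= k - 2 then 0 else k).
have idx_le t : t < 2 * k - 3 -> idx t < k.-1 by rewrite /idx; case: ifP; lia.
exists (mkseq f (2 * k - 3)); split; rewrite ?size_mkseq //.
- apply/(sortedP 0) => t; rewrite size_mkseq => lt; rewrite !nth_mkseq //; last by lia.
  rewrite /f /idx; case: (ltngtP t (k - 2)) => [tk|tk|->] /=.
  + rewrite !addn0 AS // /step_adj; move: hk; rewrite !inE.
    by case/orP => /eqP->; rewrite eqxx ?orbT.
  + have -> : 2 * k - 3 - t = (2 * k - 3 - t.+1).+1 by lia.
    rewrite AS; last by lia.
    move: (A _) => a; rewrite /step_adj; move: hk; rewrite !inE; case/orP => /eqP->.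
      by rewrite (_ : a + k.+1 + k + k.-1 = a + k + k.*2) ?modnDr ?eqxx ?orbT //; lia.
    by rewrite (_ : a + k.-1 + k + k.+1 = a + k + k.*2) ?modnDr ?eqxx //; lia.
  + rewrite (_ : 2 * k - 3 - (k - 2).+1 = k - 2); last by lia.
    by rewrite addn0 /step_adj eqxx Ar !orbT.
- rewrite -map_comp; apply/mkseq_uniqP => t t' lt lt' E.
  have Ek : idx t = idx t'.
    apply: Ainj; rewrite ?inE; try exact: idx_le.
    by move/modn_of_double: E; rewrite /f; do 2![case: ifP => _]; rewrite ?addn0 ?modnDr.
  move: E Ek; rewrite /= /f; case: ifP => tk; case: ifP => tk' + Ek; rewrite Ek ?addn0.
  + by move: Ek; rewrite /idx tk tk'.
  + by move/esym/modn_shift; lia.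
  + by move/modn_shift; lia.
  + by move: Ek lt lt'; rewrite /idx tk tk' !inE; lia.
move=> x /mapP[t]; rewrite mem_iota => lt ->; exists (idx t).
  by have := idx_le t; lia.
by rewrite /f /idx; case: ifP => _; [left; rewrite addn0|right; lia].
Qed.

(** No rung lies strictly between rungs 0 and 1 to correct the parity, so a rail loop is used. It
    omits one of these two rungs, keeps only the allowed end of the other, and crosses a single
    rung: rung k - 1, or rung 2 when r = k - 1, which differs from r because k > 3. *)
Lemma long_path_adjacent k r : 3 < k -> 1 < r < k -> exists s, long_path k r 1 s.
Proof.
move=> k3 lr.
have k0 : 0 < k by lia.
have m1 : 1 %% k.*2 = 1 by rewrite modn_small; lia.
have av (s : seq nat) : (forall x, x \in s -> x <> 0 %[mod k.*2] /\ x <> 1 %[mod k.*2]) ->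
    forall x, x \in s -> x %% k.*2 != 0 /\ x %% k.*2 != 1.
  by move=> H x /H[]; rewrite m1 mod0n => x0 x1; split; apply/eqP.
have [rk|rk] := eqVneq r k.-1.
  pose A q := (k - q) + k * q.
  have Ak q : A q = k - q %[mod k] by rewrite /A addnC mulnC modnMDl.
  have [||q lq|q q' lq lq'||s [ss us sz sP]] := @rail_loop k r A k.-1.
  - by lia.
  - by rewrite !inE eqxx orbT.
  - by rewrite /A; nia.
  - rewrite !Ak => /(@modn_window k 1); move: lq lq'; rewrite !inE; lia.
  - by rewrite Ak modn_small; lia.
  exists s; split=> //; first by rewrite sz; lia.
  apply: av => x /sP[q lq xq].
  have xk : x = k - q %[mod k] by case: xq => [|[_]] ->; rewrite ?modnDr Ak.
  have lt2 : 1 <= 1 < 1 + k /\ 1 <= k - q < 1 + k by clear -lq k3; lia.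
  split=> E; have := modn_of_double E; rewrite xk; last first.
    by move/(modn_window lt2.2 lt2.1); clear -lq k3; lia.
  have [q0 _|q_gt0] := posnP q; last first.
    have ltk : k - q < k by clear -q_gt0 k0; lia.
    by rewrite mod0n modn_small //; clear -lq k3; lia.
  move: xq E; rewrite q0 => -[->|[//]] E.
  by have := @modn_shift k 0 k0; rewrite -E /A muln0 subn0 addn0.
pose A q := q.+1 + k * q.+1.
have Ak q : A q = q.+1 %[mod k] by rewrite /A addnC mulnC modnMDl.
have [||q lq|q q' lq lq'||s [ss us sz sP]] := @rail_loop k r A k.+1.
- by lia.
- by rewrite !inE eqxx.
- by rewrite /A; nia.
- rewrite !Ak => /(@modn_window k 1); move: lq lq'; rewrite !inE; lia.
- by rewrite Ak modn_small; lia.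
exists s; split=> //; first by rewrite sz; lia.
apply: av => x /sP[q lq xq].
have xk : x = q.+1 %[mod k] by case: xq => [|[_]] ->; rewrite ?modnDr Ak.
have lt2 : 1 <= 1 < 1 + k /\ 1 <= q.+1 < 1 + k by clear -lq k3; lia.
have ltk : q.+1 < k by clear -lq k3; lia.
split=> E; have := modn_of_double E; rewrite xk; first by rewrite mod0n modn_small.
move/(modn_window lt2.2 lt2.1) => -[q0]; move: xq E; rewrite q0 => -[->|[//]].
by rewrite /A muln1 => /(modn_shift k0).
Qed.

Lemma long_path_exists k r D : 3 < k -> r <= k -> D <= k -> exists s, long_path k r D s.
Proof.
move=> k3 rk Dk.
have [D0|D0] := boolP (D \in [:: 0; k]).
  by apply: long_path_ends => //; [lia|move: D0; rewrite !inE => /orP[]/eqP; [left|right]].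
have lD : 0 < D < k by move: D0; rewrite !inE; lia.
have [r0|r0] := boolP (r \in [:: 0; D; k]); first by apply: long_path_through => //; lia.
have [lr rD] : 0 < r < k /\ r != D by move: r0; rewrite !inE; lia.
have [rltD|Dltr] := ltnP r D; first by apply: long_path_before; lia.
have [D1|D1] := eqVneq D 1; last by apply: long_path_after; lia.
by rewrite D1; apply: long_path_adjacent; lia.
Qed.

(** * The closed ladder *)

Definition dist (x y : nat) : nat := (x - y) + (y - x).

Lemma distC x y : dist x y = dist y x.
Proof. exact: addnC. Qed.

Lemma modn_add_eq n x y d : x < n -> y < n -> d <= n ->
  y = x + d %[mod n] -> y = x + d \/ y + n = x + d.
Proof.
move=> xn yn dn; rewrite [y %% n]modn_small // => ->.
have [lt|le] := ltnP (x + d) n; first by left; rewrite modn_small.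
right; rewrite -{1 2}(subnK le) modnDr modn_small //; lia.
Qed.

Section Ladder.
Variables (k r : nat).

(** Since k - 1 and k + 1 are opposite modulo 2k, a rail edge shows either value as the distance of
    representatives. A rung is named by its smaller end. *)
Definition ladder_adj : rel 'I_(k.*2) := fun x y =>
  (x != y) && [|| dist x y == k.-1, dist x y == k.+1
                | (dist x y == k) && (minn x y != r)].

Lemma ladder_sym : symmetric ladder_adj.
Proof. by move=> x y; rewrite /ladder_adj eq_sym distC minnC. Qed.

Lemma ladder_irrefl : irreflexive ladder_adj.
Proof. by move=> x; rewrite /ladder_adj eqxx. Qed.

Definition ladder : sgraph := SGraph ladder_sym ladder_irrefl.

Hypothesis k_ge6 : 6 <= k.

Lemma ladder_dist (x y : ladder) : adj x y -> k.-1 <= dist x y <= k.+1.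
Proof. by case/andP => _; lia. Qed.

(* An odd number of signed jumps, each k up to 1, cannot cancel. *)
Lemma ladder_C3_free : C3_free ladder.
Proof.
move=> x y z /ladder_dist + /ladder_dist + /ladder_dist.
have := ltn_ord x; have := ltn_ord y; have := ltn_ord z; rewrite /dist; lia.
Qed.

Lemma ladder_C5_free : C5_free ladder.
Proof.
move=> x y z u v /ladder_dist + /ladder_dist + /ladder_dist + /ladder_dist + /ladder_dist.
rewrite /dist; lia.
Qed.

Lemma double_k_gt0 : 0 < k.*2. Proof. lia. Qed.

(** Rotation carries a path that avoids positions 0 and D to one that avoids the vertices u and u +
    D. *)
Definition turn (u x : nat) : ladder := Ordinal (ltn_pmod (u + x) double_k_gt0).

Definition unturn (u y : nat) : nat := (y + (k.*2 - u)) %% k.*2.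

Lemma turnK u x : u < k.*2 -> unturn u (turn u x) = x %% k.*2.
Proof.
by move=> lu; rewrite /unturn modnDml (_ : u + x + _ = x + k.*2) ?modnDr //; lia.
Qed.

Lemma unturn_self u : u < k.*2 -> unturn u u = 0.
Proof. by move=> lu; rewrite /unturn subnKC ?modnn // ltnW. Qed.

(** The offsets from u to v and from v to u add up to 0 modulo 2k. Hence two avoided vertices can be
    ordered so that D is at most k. *)
Lemma unturn_swap u v : u < k.*2 -> v < k.*2 -> k < unturn u v -> unturn v u <= k.
Proof.
rewrite /unturn => lu lv; have [uv|vu] := leqP u v.
  rewrite (_ : v + _ = v - u + k.*2) ?modnDr; last by lia.
  have [->|uv'] := eqVneq u v; first by rewrite subnn mod0n.
  by rewrite !modn_small; lia.
rewrite (_ : u + _ = u - v + k.*2) ?modnDr; last by lia.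
by rewrite !modn_small; lia.
Qed.

Lemma rail_adj (x y : ladder) : y = x + k.+1 %[mod k.*2] -> adj x y.
Proof.
have [lx ly] := (ltn_ord x, ltn_ord y).
move/(modn_add_eq lx ly) => H; have {}H := H ltac:(lia).
by rewrite /= /ladder_adj -val_eqE /dist /=; lia.
Qed.

Lemma rung_adj (x y : ladder) : y = x + k %[mod k.*2] -> x %% k != r -> adj x y.
Proof.
have [lx ly] := (ltn_ord x, ltn_ord y).
move/(modn_add_eq lx ly) => H; have {}H := H ltac:(lia).
rewrite /= /ladder_adj -val_eqE /dist /=; case: H => H.
  by rewrite modn_small; lia.
by rewrite (_ : (x : nat) = y + k) ?modnDr ?modn_small; lia.
Qed.

Lemma step_adj_turn u r' x y : (forall z, z %% k != r' -> (u + z) %% k != r) ->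
  step_adj k r' x y -> adj (turn u x) (turn u y).
Proof.
have dv : k %| k.*2 by rewrite -mul2n dvdn_mull.
move=> Hr; case/or3P => [/eqP E|/eqP E|/andP[/eqP E nr]].
- by apply: rail_adj; rewrite /= modn_mod modnDml -addnA -modnDmr E modnDmr.
- rewrite adj_sym; apply: rail_adj; rewrite /= modn_mod modnDml.
  apply/eqP; rewrite -addnA eqn_modDl -(modnDml y) E modnDml -addnA.
  by rewrite (_ : k.-1 + k.+1 = k.*2) ?modnDr //; lia.
- apply: rung_adj; last by rewrite /= modn_dvdm // Hr.
  by rewrite /= modn_mod modnDml -addnA -modnDmr E modnDmr.
Qed.

Lemma ladder_arrows m : r \in [:: 0; k] -> 0 < m <= 2 * k - 2 - (r < k) ->
  arrows ladder (matching_graph 3) (path_graph m).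
Proof.
move=> r0 /andP[m0 lm] c; set R := color_class c Red.
have [|noM] := classic (contains_copy R (matching_graph 3)); [by left|right].
have [u [v cov]] : exists u v : R, covers [:: u; v].
  apply: cover2 noM; first exact: (turn 0 0).
  - exact: C3_free_color ladder_C3_free.
  - exact: C5_free_color ladder_C5_free.
have [lu lv] := (ltn_ord u, ltn_ord v).
wlog Dk : u v lu lv cov / unturn u v <= k.
  move=> W; have [Dk|/(unturn_swap lu lv) Dk] := leqP (unturn u v) k; first exact: (W u v).
  by apply: (W v u) => // x y /cov; rewrite !inE ![(_ == v) || _]orbC.
(* Rotating u to 0 moves the deleted rung, if any, from {0, k} to
   {r', r' + k}. *)
pose r' := if r == 0 then (k - u %% k) %% k else k.
have r'k : r' <= k by rewrite /r'; case: ifP => // _; rewrite ltnW // ltn_pmod; lia.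
have Hr z : z %% k != r' -> (u + z) %% k != r.
  move: r0; rewrite /r' !inE; case: eqVneq => [-> _|_ /= /eqP-> _]; last first.
    by have := @ltn_pmod (u + z) k; lia.
  apply: contraNneq => E; rewrite -(eqn_modDl u) E -modnDml subnKC ?modnn //.
  by rewrite ltnW // ltn_pmod; lia.
have rk : (r' < k) <= (r < k).
  by move: r0; rewrite /r' !inE; case: eqVneq => [->|_ /= /eqP->]; lia.
have [s [ss us sz sP]] := @long_path_exists k r' (unturn u v) ltac:(lia) r'k Dk.
apply: (@path_copy (color_class c Blue) m (map (turn u) s)) => //.
- apply: (@map_uniq _ _ (fun x : ladder => unturn u x)); rewrite -map_comp.
  by rewrite (eq_map (g := modn^~ k.*2)) // => x /=; exact: turnK.
- rewrite sorted_map.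
  (* The rotated path avoids the cover {u, v} of the red edges, so all its edges are blue. *)
  pose P x := (x %% k.*2 != 0) && (x %% k.*2 != unturn u v).
  apply: (@sub_in_sorted _ P) ss; last by apply/allP => x /sP[]; rewrite /P => -> ->.
  have PV x : P x -> turn u x \notin [:: u; v].
    rewrite /P !inE negb_or -!(turnK x lu) => /andP[n0 nD].
    by rewrite (contraNneq _ n0) ?(contraNneq _ nD) // => ->; rewrite ?unturn_self.
  move=> x y /PV nx /PV ny xy /=.
  have [/cov|//] := red_or_blue c (step_adj_turn Hr xy).
  by rewrite (negPf nx) (negPf ny).
by rewrite size_map; lia.
Qed.

Lemma gsize_ladder : gsize ladder <= 3 * k - (r == 0).
Proof.
(* The 2k rail edges, each taken in its direction x to x + k + 1, and the rungs by smaller end, from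
   1 on if rung 0 is deleted. *)
pose L := [seq [set turn x 0; turn x k.+1] | x <- iota 0 k.*2] ++
          [seq [set turn x 0; turn x k] | x <- iota (r == 0) (k - (r == 0))].
have <- : size L = 3 * k - (r == 0) by rewrite size_cat !size_map !size_iota; lia.
apply: gsize_le.
have railL (x y : ladder) : y = x + k.+1 :> nat \/ y + k.*2 = x + k.+1 -> [set x; y] \in L.
  move=> H; rewrite mem_cat; apply/orP; left; apply/mapP; exists (val x).
    by rewrite mem_iota /= ltn_ord.
  congr [set _; _]; apply: val_inj => /=; first by rewrite addn0 modn_small.
  by case: H => <-; rewrite ?modnDr modn_small.
have rungL (x y : ladder) : y = x + k :> nat -> x != r :> nat -> [set x; y] \in L.
  move=> H xr; rewrite mem_cat; apply/orP; right; apply/mapP; exists (val x).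
    by rewrite mem_iota /=; have := ltn_ord y; lia.
  congr [set _; _]; apply: val_inj => /=; first by rewrite addn0 modn_small.
  by rewrite -H modn_small.
move=> x y; wlog le_xy : x y / x <= y.
  by move=> W xy; case: (leqP x y) => [|/ltnW] le; [|rewrite setUC]; apply: W; rewrite // adj_sym.
case/andP => _; rewrite /dist; have -> : minn x y = x by lia.
case/or3P => [/eqP H|/eqP H|/andP[/eqP H xr]].
(* Here y = x + k - 1, so the jump of k + 1 goes from y to x and wraps around. *)
- by rewrite setUC; apply: railL; lia.
- by apply: railL; lia.
- by apply: rungL; lia.
Qed.

End Ladder.

Lemma connected_from (F : sgraph) (x0 : F) :
  (forall x, connect (@adj F) x0 x) -> connected F.
Proof.
move=> H; split=> [|x y]; first by apply/card_gt0P; exists x0.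
by apply: connect_trans (H y); rewrite (sym_connect_sym (@adj_sym F)).
Qed.

(** Outside rung 0, a rung followed by a rail edge leads from x to x + 1. This links 1, ..., k and k
    + 1, ..., 2k, the last being vertex 0, and rung 1 joins the two runs. *)
Lemma ladder_connected k r (k_ge6 : 6 <= k) : r \in [:: 0; k] -> connected (ladder k r).
Proof.
move=> r0; have k0 : 0 < k by lia.
pose C x y := connect (@adj (ladder k r)) (turn r k_ge6 0 x) (turn r k_ge6 0 y).
have Csym x y : C x y = C y x by exact: (sym_connect_sym (@adj_sym _)).
have modE x y : x = y %[mod k.*2] -> turn r k_ge6 0 x = turn r k_ge6 0 y.
  by move=> E; apply: val_inj.
have step x y : step_adj k r x y -> C x y.
  by move=> xy; apply/connect1; apply: step_adj_turn xy => z; rewrite add0n.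
have rung x : x %% k != 0 -> C x (x + k).
  move=> x0; apply: step; rewrite /step_adj eqxx /= !orbA; apply/orP; right.
  by move: r0; rewrite !inE => /orP[]/eqP-> //; have := @ltn_pmod x k; lia.
have next x : x %% k != 0 -> C x x.+1.
  move=> /rung xk; apply: connect_trans xk _; apply: step.
  by rewrite /step_adj (_ : x + k + k.+1 = x.+1 + k.*2) ?modnDr ?eqxx //; lia.
have C1 x : 0 < x <= k -> C 1 x.
  elim: x => // -[|x] IH lx; first exact: connect0.
  by apply: connect_trans (IH _) (next _ _); rewrite ?modn_small; lia.
have C2 x : 0 < x <= k -> C 1 (x + k).
  have Ck : C 1 k.+1 by rewrite -addn1 addnC; apply: rung; rewrite modn_small; lia.
  elim: x => // -[|x] IH lx; first by rewrite add1n.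
  apply: connect_trans (IH _) _; first by lia.
  by rewrite (addSn x.+1); apply: next; rewrite modnDr modn_small; lia.
apply: (@connected_from _ (turn r k_ge6 0 1)) => y.
have ly := ltn_ord y.
have -> : y = turn r k_ge6 0 y by apply: val_inj; rewrite /= add0n modn_small.
have [y0|y_gt0] := posnP y.
  rewrite (modE y (k + k)); first by apply: C2; lia.
  by rewrite y0 addnn modnn mod0n.
have [yk|ky] := leqP y k; first by apply: C1; lia.
by rewrite -(subnK (ltnW ky)); apply: C2; lia.
Qed.

(** * Adding cycles *)

Section Cycle.
Variable m : nat.

Definition cycle_adj : rel 'I_m.+1 := fun x y =>
  (x != y) && ((dist x y == 1) || (dist x y == m)).

Lemma cycle_sym : symmetric cycle_adj.
Proof. by move=> x y; rewrite /cycle_adj eq_sym distC. Qed.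

Lemma cycle_irrefl : irreflexive cycle_adj.
Proof. by move=> x; rewrite /cycle_adj eqxx. Qed.

Definition cycle_graph : sgraph := SGraph cycle_sym cycle_irrefl.

Definition cycle_vertex (x : nat) : cycle_graph := Ordinal (ltn_pmod x (ltn0Sn m)).

Hypothesis m_ge3 : 3 <= m.

Lemma cycle_C3_free : C3_free cycle_graph.
Proof.
move=> x y z; rewrite /= /cycle_adj -!val_eqE /dist /=.
by have := ltn_ord x; have := ltn_ord y; have := ltn_ord z; lia.
Qed.

Lemma adj_cycle_vertexS x : adj (cycle_vertex x) (cycle_vertex x.+1).
Proof.
have [lx ly] := (ltn_ord (cycle_vertex x), ltn_ord (cycle_vertex x.+1)).
have H := @modn_add_eq m.+1 (cycle_vertex x) (cycle_vertex x.+1) 1 lx ly.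
have {}H := H isT; rewrite /= modn_mod modnDml addn1 in H.
rewrite /= /cycle_adj -val_eqE /dist /=; have := H erefl.
by move: lx ly => /=; lia.
Qed.

(** The cycle has at least four vertices, hence no triangle. If there is no red 2K_2, one vertex
    covers the red edges, and removing it from the cycle leaves a blue path on m vertices. *)
Lemma cycle_arrows : arrows cycle_graph (matching_graph 2) (path_graph m).
Proof.
move=> c; set R := color_class c Red.
have [|noM] := classic (contains_copy R (matching_graph 2)); [by left|right].
have [u cov] : exists u : R, covers [:: u].
  by apply: cover1 noM; [exact: (cycle_vertex 0)|exact: C3_free_color cycle_C3_free].
have avoid i : i < m -> cycle_vertex (u + i.+1) != u.
  move=> lt; apply/eqP => /(congr1 val) /= E; have lu := ltn_ord u.
  have /eqP : u + i.+1 = u + 0 %[mod m.+1] by rewrite E addn0 modn_small.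
  by rewrite eqn_modDl mod0n modn_small.
apply: (@path_copy (color_class c Blue) m (mkseq (fun i => cycle_vertex (u + i.+1)) m)).
- by lia.
- apply/mkseq_uniqP => i j; rewrite !inE => li lj /(congr1 val) /= /eqP.
  by rewrite eqn_modDl !modn_small // => /eqP[].
- apply/(sortedP u) => i; rewrite size_mkseq => lt; rewrite !nth_mkseq //; last by lia.
  have := adj_cycle_vertexS (u + i.+1); rewrite -addnS => /(red_or_blue c)[/cov|//].
  by rewrite !inE !(negPf (avoid _ _)) //; lia.
- by rewrite size_mkseq.
Qed.

Lemma gsize_cycle : gsize cycle_graph <= m.+1.
Proof.
pose L := [seq [set cycle_vertex x; cycle_vertex x.+1] | x <- iota 0 m.+1].
have <- : size L = m.+1 by rewrite size_map size_iota.
apply: gsize_le.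
have inL (x y : cycle_graph) : y = x.+1 %% m.+1 :> nat -> [set x; y] \in L.
  move=> H; apply/mapP; exists (val x); first by rewrite mem_iota /= ltn_ord.
  by congr [set _; _]; apply: val_inj; rewrite //= modn_small.
move=> x y; wlog le_xy : x y / x <= y.
  by move=> W xy; case: (leqP x y) => [|/ltnW] le; [|rewrite setUC]; apply: W; rewrite // adj_sym.
have ly := ltn_ord y.
case/andP => _; rewrite /dist => /orP[]/eqP H.
  by apply: inL; rewrite modn_small; lia.
rewrite setUC; apply: inL.
have -> : (y : nat) = m by lia.
by rewrite modnn; lia.
Qed.

Lemma cycle_connected : connected cycle_graph.
Proof.
apply: (@connected_from _ (cycle_vertex 0)) => y.
have -> : y = cycle_vertex y by apply: val_inj; rewrite /= modn_small.
elim: (y : nat) => [|i IH]; first exact: connect0.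
by apply: connect_trans IH (connect1 (adj_cycle_vertexS i)).
Qed.

End Cycle.

(** * Disjoint unions, optionally joined by an edge *)

Section Glue.
Variables (F G : sgraph) (e : option (F * G)).

(** One construction serves both bounds: [None] gives the disjoint union, [Some (x, y)] adds a
    bridge to make it connected. *)
Definition glue_adj : rel (F + G)%type := fun u v =>
  match u, v with
  | inl x, inl y => adj x y
  | inr x, inr y => adj x y
  | inl x, inr y | inr y, inl x => e == Some (x, y)
  end.

Lemma glue_sym : symmetric glue_adj.
Proof. by case=> x [] y //=; exact: adj_sym. Qed.

Lemma glue_irrefl : irreflexive glue_adj.
Proof. by case=> x /=; exact: adj_irrefl. Qed.

Definition glue : sgraph := SGraph glue_sym glue_irrefl.

Lemma gsize_glue : gsize glue <= gsize F + gsize G + (e != None).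
Proof.
pose L := [seq (@inl F G) @: (A : {set F}) | A <- enum (edges F)] ++
  [seq (@inr F G) @: (A : {set G}) | A <- enum (edges G)] ++
  (if e is Some (x, y) then [:: [set inl x; inr y]] else [::]).
have <- : size L = gsize F + gsize G + (e != None).
  by rewrite !size_cat !size_map -!cardE addnA; case: e => [[]|].
have edgeP (H : sgraph) (x y : H) : adj x y -> [set x; y] \in enum (edges H).
  move=> xy; rewrite mem_enum inE; apply/existsP; exists x; apply/existsP; exists y.
  by rewrite xy eqxx.
apply: gsize_le; rewrite /L.
have imE (T1 T2 : finType) (f : T1 -> T2) x y : [set f x; f y] = f @: [set x; y] :> {set T2}.
  by rewrite imsetU1 imset_set1.
case=> x [] y /= xy; rewrite !mem_cat.
- by rewrite imE map_f ?edgeP.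
- by rewrite (eqP xy) inE eqxx !orbT.
- by rewrite (eqP xy) inE setUC eqxx !orbT.
- by rewrite imE map_f ?edgeP ?orbT.
Qed.

Lemma glue_connected : connected F -> connected G -> e != None -> connected glue.
Proof.
move=> [_ cF] [_ cG]; case He : e => [[a b]|//] _.
have emb (H : sgraph) (f : H -> glue) : (forall x y, adj x y -> adj (f x) (f y)) ->
    forall x y, connect (@adj H) x y -> connect (@adj glue) (f x) (f y).
  move=> fadj x y /connectP[p pp ->]; elim: p x pp => [|z p IH] x /=.
    by move=> _; exact: connect0.
  by case/andP => /fadj/connect1 xz /IH; exact: connect_trans.
apply: (@connected_from glue (inl a)) => -[x|y].
  by apply: (emb F (@inl F G)).
apply: connect_trans (emb G (@inr F G) _ b y (cG b y)) => //.
by apply: connect1; rewrite /= He.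
Qed.

(** Each part inherits the coloring. A blue [H] in a part is one in the whole; otherwise both parts
    contain red matchings, which are disjoint and add up. *)
Lemma glue_arrows s t H : arrows F (matching_graph s) H -> arrows G (matching_graph t) H ->
  arrows glue (matching_graph (s + t)) H.
Proof.
move=> aF aG c.
have lift (K : sgraph) (f : K -> glue) a x y : (forall x y, adj x y -> adj (f x) (f y)) ->
    color_adj (fun A : {set K} => c (f @: A)) a x y -> color_adj c a (f x) (f y).
  by move=> fadj /andP[/fadj xy]; rewrite /color_adj xy imsetU1 imset_set1.
have liftF a x y := @lift F (@inl F G) a x y (fun _ _ => id).
have liftG a x y := @lift G (@inr F G) a x y (fun _ _ => id).
case: (aF (fun A : {set F} => c ((@inl F G) @: A))) => -[f f_inj f_adj]; last first.
  by right; exists (inl \o f) => [x y [/f_inj]|x y /f_adj /liftF].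
case: (aG (fun A : {set G} => c ((@inr F G) @: A))) => -[g g_inj g_adj]; last first.
  by right; exists (inr \o g) => [x y [/g_inj]|x y /g_adj /liftG].
left; exists (fun u : matching_graph (s + t) => match split u.1 with
    inl i => inl (f (i, u.2)) | inr i => inr (g (i, u.2)) end : glue).
  move=> [i x] [j y] /=; rewrite -[i in (i, x)]splitK -[j in (j, y)]splitK.
  by case: (split i) (split j) => i' [] j' // [] => [/f_inj|/g_inj] [-> ->].
move=> [i x] [j y] /andP[/= /eqP<- xy].
by case: (split i) => i'; [apply/liftF/f_adj|apply/liftG/g_adj];
  rewrite /= /matching_adj /= eqxx.
Qed.

End Glue.

(** * The bounds for all odd t *)

(** Each of the q steps glues on one cycle. The flag [b] asks for connectivity and, read as a
    number, pays for the bridge. *)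
Lemma arrows_tower (m q N : nat) (b : bool) (F : sgraph) : 3 <= m ->
  arrows F (matching_graph 3) (path_graph m) -> gsize F <= N -> connected F ->
  exists2 F' : sgraph, arrows F' (matching_graph (3 + q.*2)) (path_graph m) /\
      (b -> connected F') & gsize F' <= N + q * (m + 1 + b).
Proof.
move=> m3 aF sF cF; elim: q => [|q [F' [aF' cF'] sF']].
  by exists F; rewrite ?addn0.
have tE : 3 + q.+1.*2 = 3 + q.*2 + 2 by lia.
case: b cF' sF' => cF' sF'; last first.
  exists (@glue F' (cycle_graph m) None).
    by split=> //; rewrite tE; apply: glue_arrows (cycle_arrows m3).
  apply: leq_trans (gsize_glue _) _; rewrite eqxx addn0.
  by have := gsize_cycle m3; lia.
have [/card_gt0P[x _] _] := cF' isT.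
exists (@glue F' (cycle_graph m) (Some (x, cycle_vertex m 0))).
  split=> [|_]; first by rewrite tE; apply: glue_arrows (cycle_arrows m3).
  by apply: glue_connected => //; [exact: cF'|exact: cycle_connected].
apply: leq_trans (gsize_glue _) _.
by have := gsize_cycle m3; lia.
Qed.

(* The number uphalf n is the ceiling of n / 2.  As t is odd, t - 3 is even, so
   the halved products are exact. *)
Theorem theorem4p3 (t m : nat) (odd_t : odd t) (t_ge3 : 3 <= t) (m_ge9 : 9 <= m) :
  (exists2 r : nat, is_size_ramsey (matching_graph t) (path_graph m) r &
     r <= uphalf (3 * m + 7) + ((t - 3) * (m + 1))./2) /\
  (exists2 r : nat, is_connected_size_ramsey (matching_graph t) (path_graph m) r &
     r <= uphalf (3 * m + 7) + ((t - 3) * (m + 2))./2).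
Proof.
have [q ->] : exists q, t = 3 + q.*2 by exists (t - 3)./2; lia.
have halfE n : ((3 + q.*2 - 3) * n)./2 = q * n by rewrite addKn -doubleMl doubleK.
rewrite !halfE.
(* For even m, 2k - 2 = m and the full ladder has 3k = (3m + 6) / 2 edges. For odd m, 2k - 3 = m,
   and deleting rung 0 leaves 3k - 1 = (3m + 7) / 2. The bound m >= 9 gives k >= 6, which excludes
   5-cycles. *)
pose k := (m + 3)./2; pose r := if odd m then 0 else k.
have k6 : 6 <= k by rewrite /k; lia.
have r0 : r \in [:: 0; k] by rewrite /r; case: ifP; rewrite !inE eqxx ?orbT.
have aF : arrows (ladder k r) (matching_graph 3) (path_graph m).
  by apply: ladder_arrows => //; rewrite /r /k; case: ifP; lia.
have sF : gsize (ladder k r) <= uphalf (3 * m + 7).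
  by apply: leq_trans (gsize_ladder r k6) _; rewrite /r /k; case: ifP; lia.
have cF := ladder_connected k6 r0.
have m3 : 3 <= m by lia.
have [F [aF1 _] sF1] := @arrows_tower m q _ false _ m3 aF sF cF.
have [G [aG1 cG] sG1] := @arrows_tower m q _ true _ m3 aF sF cF.
rewrite addn0 in sF1; rewrite -addnA in sG1.
by split; [exact: ex_min_size sF1|apply: ex_min_size sG1; split; first exact: cG].
Qed.
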